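(* Let $U:[0,\infty)\to\mathbb{R}$ be a bounded upper semicontinuous viscosity subsolution and $V:[0,\infty)\to\mathbb{R}$ a bounded lower semicontinuous viscosity supersolution of the equation $\mathcal{L}w=0$ in $(0,\infty)$. If $U(0)\le V(0)$ and $\limsup_{u\to\infty}(U(u)-V(u))\le0$, then $U(u)\le V(u)$ for all $u\in[0,\infty)$.
   Context: Parameters: $\lambda>0$, $c>0$, $\sigma>0$, $a>\sigma^2/2$, and $F$ is a probability distribution function on $(0,\infty)$ (i.e. $F(0)=0$) with finite first moment whose topological support is $(0,\infty)$, i.e. $F(I)>0$ for every open interval $I\subset(0,\infty)$ (standing assumptions). Operator: for $\varphi\in C^2((0,\infty))\cap C_b([0,\infty))$ and $u>0$, $\mathcal{L}\varphi(u)=\frac{\sigma^2u^2}{2}\varphi''(u)+(au-c)\varphi'(u)+\lambda\int_0^\infty[\varphi(u+y)-\varphi(u)]\,dF(y)$. For a locally bounded $w:[0,\infty)\to\mathbb{R}$, let $w^*(x)=\limsup_{y\to x}w(y)$ and $w_*(x)=\liminf_{y\to x}w(y)$. The function $w$ is a viscosity subsolution of $\mathcal{L}w=0$ in $(0,\infty)$ if for every $x_0\in(0,\infty)$ and every $\varphi\in C^2((0,\infty))\cap C_b([0,\infty))$ with $w^*(x_0)=\varphi(x_0)$ and $w^*(x)\le\varphi(x)$ both for all $x$ in some neighborhood of $x_0$ and for all $x\ge x_0$, one has $\mathcal{L}\varphi(x_0)\ge0$. It is a viscosity supersolution if for every $x_0\in(0,\infty)$ and every such $\varphi$ with $w_*(x_0)=\varphi(x_0)$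 and $w_*(x)\ge\varphi(x)$ both in some neighborhood of $x_0$ and for all $x\ge x_0$, one has $\mathcal{L}\varphi(x_0)\le0$. *)

(* Defs.v *)
From HB Require Import structures.
From mathcomp Require Import all_boot all_order all_algebra.
From mathcomp Require Import all_classical all_reals all_analysis.
Set Implicit Arguments. Unset Strict Implicit. Unset Printing Implicit Defensive.
Import Order.TTheory GRing.Theory Num.Theory.
Import numFieldNormedType.Exports.
Local Open Scope classical_set_scope.
Local Open Scope ring_scope.

Section Defs.
Context {R : realType}.

Definition posR : set R := `]0, +oo[.

(* A probability distribution function on (0,oo): a cumulative distribution
   function F (nondecreasing, right-continuous, F(-oo)=0, F(+oo)=1) with F 0 = 0. *)
Definition distr_on_pos (F : cumulativeBounded (0:R) (1:R)) : Prop := F 0 = 0.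

Definition finite_first_moment (F : cumulativeBounded (0:R) (1:R)) : Prop :=
  (\int[lebesgue_stieltjes_measure F]_(y in posR) (y%:E) < +oo)%E.

Definition full_support_pos (F : cumulativeBounded (0:R) (1:R)) : Prop :=
  forall a b : R, 0 <= a -> a < b ->
    (0 < lebesgue_stieltjes_measure F `]a, b[)%E.

Definition test_fun (phi : R -> R) : Prop :=
  (forall x : R, 0 < x ->
     [/\ derivable phi x 1, derivable (derive1 phi) x 1 & {for x, continuous (derive1n 2 phi)}])
  /\ {within `[0, +oo[, continuous phi}
  /\ exists M : R, forall x : R, 0 <= x -> `|phi x| <= M.

Definition opL (lam c sigma a : R) (F : cumulativeBounded (0:R) (1:R))
  (phi : R -> R) (u : R) : R :=
  sigma ^+ 2 * u ^+ 2 / 2 * (derive1n 2 phi) u + (a * u - c) * (derive1 phi) u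
  + lam * Rintegral (lebesgue_stieltjes_measure F) posR
            (fun y => phi (u + y) - phi u).

Definition upper_env (w : R -> R) (x : R) : R :=
  inf [set sup [set w y | y in [set y : R | 0 <= y /\ `|y - x| < r]]
      | r in [set r : R | 0 < r]].

Definition lower_env (w : R -> R) (x : R) : R :=
  sup [set inf [set w y | y in [set y : R | 0 <= y /\ `|y - x| < r]]
      | r in [set r : R | 0 < r]].

Definition visc_sub (lam c sigma a : R) (F : cumulativeBounded (0:R) (1:R))
  (w : R -> R) : Prop :=
  forall (x0 : R) (phi : R -> R), 0 < x0 -> test_fun phi ->
    upper_env w x0 = phi x0 ->
    (exists2 d : R, 0 < d & forall x, 0 <= x -> `|x - x0| < d ->
                              upper_env w x <= phi x) ->
    (forall x, x0 <= x -> upper_env w x <= phi x) ->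
    0 <= opL lam c sigma a F phi x0.

Definition visc_super (lam c sigma a : R) (F : cumulativeBounded (0:R) (1:R))
  (w : R -> R) : Prop :=
  forall (x0 : R) (phi : R -> R), 0 < x0 -> test_fun phi ->
    lower_env w x0 = phi x0 ->
    (exists2 d : R, 0 < d & forall x, 0 <= x -> `|x - x0| < d ->
                              phi x <= lower_env w x) ->
    (forall x, x0 <= x -> phi x <= lower_env w x) ->
    opL lam c sigma a F phi x0 <= 0.

Definition usc_pos (w : R -> R) : Prop :=
  forall x : R, 0 <= x -> forall e : R, 0 < e ->
    exists2 d : R, 0 < d & forall y, 0 <= y -> `|y - x| < d -> w y < w x + e.

Definition lsc_pos (w : R -> R) : Prop :=
  forall x : R, 0 <= x -> forall e : R, 0 < e ->
    exists2 d : R, 0 < d & forall y, 0 <= y -> `|y - x| < d -> w x - e < w y.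

Definition bounded_pos (w : R -> R) : Prop :=
  exists M : R, forall x : R, 0 <= x -> `|w x| <= M.

End Defs.

(* Main.v *)
(** Both [U] and [- V] are upper semicontinuous subsolutions, so it suffices to
    exclude an interior positive maximum [x0] of [U + (- V)].  At such a point
    full support makes the sum of the two jump integrals negative, and this
    survives replacing the functions inside the integrals by C^2 majorants
    close to them.  In one dimension the theorem on sums is not needed: near
    [x0] each subsolution lies below its chords in the scale function of the
    diffusion part, up to a correction [k (x - x0)^2] in which [k] balances the
    jump integral.  Adding the two chord inequalities on [x0 - r, x0 + r], the
    corrections add up to a strictly positive amount and contradict
    maximality. *)
Require Import Defs.
From HB Require Import structures.
From mathcomp Require Import all_boot all_order all_algebra.
From mathcomp Require Import all_classical all_reals all_analysis.
From mathcomp Require Import measurable_realfun ring lra.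
Set Implicit Arguments. Unset Strict Implicit. Unset Printing Implicit Defensive.
Import Order.TTheory GRing.Theory Num.Theory.
Import numFieldNormedType.Exports.
Local Open Scope classical_set_scope.
Local Open Scope ring_scope.

(** The operator has no zero-order term, so strictness at the maximum must come from the jumps: the
    condition at infinity gives a half-line where [U - V] is at most half of one of its positive
    values, and [F] charges the jumps into it. The chord comparison needs the strict inequality on a
    whole window around [x0], where the jump term at [x] contains [- U x] with [U] only upper
    semicontinuous. This is the main obstacle, and it forces each subsolution to be shown lower
    semicontinuous at positive points beforehand. The same chords serve there: against a constant
    majorant the jump term is merely bounded, and a large multiple of the square dominates it
    without any regularity of [U]. Majorants appear because the definition evaluates the nonlocal
    term on the test function, which must dominate [U] to the right of the contact point; by
    monotonicity any larger test function may stand in. Windows stay to the right of [x0 / 2], away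
    from the degeneracy of the diffusion at 0. *)

(** * Calculus of explicit second-order jets *)

Section Jet2.
Context {R : realType}.
Implicit Types (f g : R -> R) (x k : R).

(** The derivatives are explicit functions, not [derive1 f], so that jets of sums, products and
    compositions can be computed. A jet at one point becomes a C^2 statement only when it holds on a
    neighbourhood. *)
Definition jet2 (f f1 f2 : R -> R) (x : R) : Prop :=
  [/\ is_derive x 1 f (f1 x), is_derive x 1 f1 (f2 x) & {for x, continuous f2}].

Lemma is_derive_continuous f x (d : R) : is_derive x 1 f d -> {for x, continuous f}.
Proof. by case=> df _; apply/differentiable_continuous/derivable1_diffP. Qed.

Lemma jet2_continuous f f1 f2 x : jet2 f f1 f2 x -> {for x, continuous f}.
Proof. by case=> /is_derive_continuous. Qed.

Lemma jet2_continuous1 f f1 f2 x : jet2 f f1 f2 x -> {for x, continuous f1}.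
Proof. by case=> _ /is_derive_continuous. Qed.

Lemma jet2_cst k x : jet2 (cst k) (cst 0) (cst 0) x.
Proof. by split; [exact: is_derive_cst|exact: is_derive_cst|exact: cvg_cst]. Qed.

Lemma jet2_id x : jet2 id (cst 1) (cst 0) x.
Proof. by split; [exact: is_derive_id|exact: is_derive_cst|exact: cvg_cst]. Qed.

Lemma jet2D f f1 f2 g g1 g2 x : jet2 f f1 f2 x -> jet2 g g1 g2 x ->
  jet2 (f \+ g) (f1 \+ g1) (f2 \+ g2) x.
Proof.
move=> [? ? cf] [? ? cg]; split; [exact: is_deriveD|exact: is_deriveD|].
exact: (cvgD cf cg).
Qed.

Lemma jet2M f f1 f2 g g1 g2 x : jet2 f f1 f2 x -> jet2 g g1 g2 x ->
  jet2 (f \* g) (f1 \* g \+ f \* g1) (f2 \* g \+ f1 \* g1 \+ (f1 \* g1 \+ f \* g2)) x.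
Proof.
move=> jf jg; have [df df1 cf2] := jf; have [dg dg1 cg2] := jg.
have cf := jet2_continuous jf; have cg := jet2_continuous jg.
have cf1 := jet2_continuous1 jf; have cg1 := jet2_continuous1 jg.
split.
- by apply: (is_derive_eq (is_deriveM df dg)); rewrite /GRing.scale/=; ring.
- apply: (is_derive_eq (is_deriveD (is_deriveM df1 dg) (is_deriveM df dg1))).
  by rewrite /GRing.scale/=; ring.
- exact: (cvgD (cvgD (cvgM cf2 cg) (cvgM cf1 cg1))
               (cvgD (cvgM cf1 cg1) (cvgM cf cg2))).
Qed.

Lemma jet2Z k f f1 f2 x : jet2 f f1 f2 x ->
  jet2 (fun y => k * f y) (fun y => k * f1 y) (fun y => k * f2 y) x.
Proof.
move=> [df df1 cf2]; split.
- exact: (is_deriveZ k df).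
- exact: (is_deriveZ k df1).
- exact: (cvgM (cvg_cst k) cf2).
Qed.

Lemma jet2_comp f f1 f2 g g1 g2 x : jet2 f f1 f2 x -> jet2 g g1 g2 (f x) ->
  jet2 (g \o f) (fun y => g1 (f y) * f1 y)
       (fun y => g2 (f y) * f1 y * f1 y + g1 (f y) * f2 y) x.
Proof.
move=> jf jg; have [df df1 cf2] := jf; have [dg dg1 cg2] := jg.
have cf := jet2_continuous jf.
have cf1 := jet2_continuous1 jf; have cg1 := jet2_continuous1 jg.
have cg1f : {for x, continuous (g1 \o f)} by exact: continuous_comp.
have cg2f : {for x, continuous (g2 \o f)} by exact: continuous_comp.
split.
- exact: is_derive1_comp.
- apply: (is_derive_eq (is_deriveM (is_derive1_comp dg1 df) df1)).
  by rewrite /GRing.scale/=; ring.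
- exact: (cvgD (cvgM (cvgM cg2f cf1) cf1) (cvgM cg1f cf2)).
Qed.

Lemma jet2_near_eq f g f1 f2 x : (\forall y \near x, f y = g y) ->
  jet2 f f1 f2 x -> jet2 g f1 f2 x.
Proof. by move=> fg [df ? ?]; split=> //; exact: near_eq_is_derive df. Qed.

Lemma jet2_ext f g f1 f2 x : f =1 g -> jet2 f f1 f2 x -> jet2 g f1 f2 x.
Proof. by move=> /funext ->. Qed.

Lemma jet2_eq_jets f f1 f2 g1 g2 x : jet2 f f1 f2 x -> f1 =1 g1 -> f2 =1 g2 ->
  jet2 f g1 g2 x.
Proof. by move=> jf /funext <- /funext <-. Qed.

(** Differentiability of [derive1 f] at [x] involves its values around [x], hence the hypothesis on
    a neighbourhood: there [f1] coincides with [derive1 f], and then [f2] with the second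
    derivative. *)
Lemma near_jet2_derive f f1 f2 x : (\forall y \near x, jet2 f f1 f2 y) ->
  [/\ derivable f x 1, derivable (derive1 f) x 1 & {for x, continuous (derive1n 2 f)}] /\
  (derive1 f x = f1 x /\ derive1n 2 f x = f2 x).
Proof.
move=> jf.
have e1 : \forall y \near x, f1 y = derive1 f y.
  by apply: filterS jf => y [[_ <-] _ _]; rewrite derive1E.
have e2 : \forall y \near x, f2 y = derive1n 2 f y.
  have e11 : \forall y \near x, \forall z \near y, f1 z = derive1 f z by apply/near_join.
  apply: filterS2 e11 jf => y ey [_ d1 _].
  by have [_ <-] := near_eq_is_derive ey d1; rewrite -derive1E.
have [[df dfe] df1 cf2] := nbhs_singleton jf.
split; [split=> //|split].
- by have [] := near_eq_is_derive e1 df1.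
- rewrite /prop_for /continuous_at -(nbhs_singleton e2).
  by apply: cvg_trans cf2; apply: near_eq_cvg; apply: filterS e2 => y ->.
- by rewrite -(nbhs_singleton e1).
- by rewrite -(nbhs_singleton e2).
Qed.

End Jet2.

(** * A C^2 step function *)

Section Step.
Context {R : realType}.

Definition pospow n (t : R) : R := (Num.max t 0) ^+ n.

Lemma pospow_continuous n : continuous (pospow n).
Proof.
move=> x; apply: (@continuous_comp _ _ _ (fun t : R => Num.max t 0) (fun t => t ^+ n)).
  exact: (@continuous_max R R id (cst 0) x cvg_id (cvg_cst 0)).
exact: exprn_continuous.
Qed.

Lemma is_derive_pospow n (x : R) :
  is_derive x 1 (pospow n.+2) (n.+2%:R * pospow n.+1 x).
Proof.
have [x0|x0|->] := ltrgtP x 0.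
- rewrite /pospow (max_idPr (ltW x0)) expr0n mulr0.
  apply: (near_eq_is_derive (f := cst (0:R))).
  by near=> y; rewrite (max_idPr _) ?expr0n//; apply/ltW; near: y; exact: lt_nbhsl.
- have dx : is_derive x 1 (fun t : R => t ^+ n.+2) (n.+2%:R * pospow n.+1 x).
    rewrite (_ : (fun t : R => _) = id ^+ n.+2); last by apply/funext => t; rewrite exprfctE.
    apply: (is_derive_eq (is_deriveX n.+2 (is_derive_id x (1:R)))).
    by rewrite /pospow (max_idPl (ltW x0)) /GRing.scale/= mulr1 mulr_natl.
  apply: near_eq_is_derive dx.
  near=> y; rewrite /pospow (max_idPl _)//; apply/ltW; near: y; exact: lt_nbhsr.
(* At the corner, [pospow n.+2 z = pospow n.+1 z * z] exhibits [pospow n.+1] as a continuous slope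
   function vanishing at 0. *)
- apply/is_derive1_caratheodory; exists (pospow n.+1); split.
  + move=> z; rewrite /pospow maxxx expr0n !subr0 exprSr.
    by have [z0|z0] := leP z 0; rewrite ?mulr0 ?expr0n ?mul0r.
  + exact: pospow_continuous.
  + by rewrite /pospow maxxx !expr0n mulr0.
Unshelve. all: by end_near. Qed.

Lemma jet2_pospow3 (x : R) :
  jet2 (pospow 3) (fun t => 3 * pospow 2 t) (fun t => 3 * (2 * pospow 1 t)) x.
Proof.
split; first exact: is_derive_pospow.
- exact: (is_deriveZ 3 (is_derive_pospow 0 x)).
- have c1 : {for x, continuous (pospow 1)} by exact: pospow_continuous.
  exact: (cvgM (cvg_cst (3:R)) (cvgM (cvg_cst (2:R)) c1)).
Qed.

(** The cube of the positive part is flat to second order at 0; applying it again to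
    [1 - pospow 3 t] flattens the junction at 1 in the same way. *)
Definition step (t : R) : R := 1 - pospow 3 (1 - pospow 3 t).

Lemma step_jet2 : exists s1 s2, forall x, jet2 step s1 s2 x.
Proof.
eexists; eexists => x.
have j1 := jet2D (jet2_cst 1 x) (jet2Z (-1) (jet2_pospow3 x)).
have j2 := jet2D (jet2_cst 1 x) (jet2Z (-1) (jet2_comp j1 (jet2_pospow3 _))).
by apply: jet2_ext j2 => y; rewrite /step /= !mulN1r.
Qed.

Lemma pospow_ge0 n t : 0 <= pospow n t.
Proof. by rewrite exprn_ge0// le_max lexx orbT. Qed.

Lemma step_le0 t : t <= 0 -> step t = 0.
Proof.
move=> t0; rewrite /step /pospow (max_idPr t0) expr0n subr0.
by rewrite (max_idPl ler01) expr1n subrr.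
Qed.

Lemma step_ge1 t : 1 <= t -> step t = 1.
Proof.
move=> t1; rewrite /step {1}/pospow (max_idPr _) ?expr0n ?subr0//.
by rewrite subr_le0 /pospow exprn_ege1// le_max t1.
Qed.

Lemma step_ge0 t : 0 <= step t.
Proof.
rewrite /step subr_ge0 {1}/pospow exprn_ile1//; first by rewrite le_max lexx orbT.
by rewrite ge_max ler01 andbT gerBl pospow_ge0.
Qed.

Lemma step_le1 t : step t <= 1.
Proof. by rewrite /step gerBl pospow_ge0. Qed.

Lemma step_jet2_affine (k b : R) :
  exists s1 s2, forall x, jet2 (fun t => step (k * t + b)) s1 s2 x.
Proof.
have [s1 [s2 js]] := step_jet2.
eexists; eexists => x.
exact: (jet2_comp (jet2D (jet2Z k (jet2_id x)) (jet2_cst b x)) (js _)).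
Qed.

End Step.

(** * Semicontinuous envelopes and attainment of maxima *)

Section Semicontinuity.
Context {R : realType}.
Implicit Types (U V w : R -> R) (x : R).

(** Boundedness makes each inner [sup] a genuine supremum instead of a default value, and [U x]
    bounds all of them from below, so the outer [inf] is genuine too. *)
Lemma upper_env_usc U x : bounded_pos U -> usc_pos U -> 0 <= x ->
  upper_env U x = U x.
Proof.
move=> [M bM] uU x0; rewrite /upper_env.
set A := (X in inf X).
have sub (r : R) : 0 < r ->
    has_sup [set U y | y in [set y : R | 0 <= y /\ `|y - x| < r]].
  move=> r0; split; first by exists (U x), x => //=; rewrite subrr normr0.
  by exists M => _ /= [y [y0 _] <-]; exact: le_trans (ler_norm _) (bM _ y0).
have lbA : lbound A (U x).
  move=> _ /= [r r0 <-]; apply: ub_le_sup; first by have [] := sub r r0.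
  by exists x => //=; rewrite subrr normr0.
apply/le_anti/andP; split.
- apply/ler_addgt0Pr => e e0.
  have [d d0 Ud] := uU x x0 e e0.
  apply: (@le_trans _ _ (sup [set U y | y in [set y : R | 0 <= y /\ `|y - x| < d]])).
    by apply: ge_inf; [exists (U x)|exists d].
  apply: ge_sup; first by have [] := sub d d0.
  by move=> _ /= [y [y0 yd] <-]; exact/ltW/Ud.
- apply: lb_le_inf => //.
  by eexists; exists 1; [exact: ltr01|reflexivity].
Qed.

Lemma lower_envN w x : lower_env w x = - upper_env (\- w) x.
Proof.
rewrite /lower_env /upper_env /inf opprK; congr sup.
rewrite image_comp; apply/eq_imagel => r _ /=; congr (- sup _).
by rewrite image_comp.
Qed.

Lemma lsc_oppP V : lsc_pos V -> usc_pos (\- V).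
Proof.
move=> lV x x0 e e0; have [d d0 Vd] := lV x x0 e e0; exists d => // y y0 yd /=.
by have := Vd y y0 yd; lra.
Qed.

Lemma bounded_posN V : bounded_pos V -> bounded_pos (\- V).
Proof. by move=> [M bM]; exists M => x x0; rewrite normrN bM. Qed.

Lemma usc_posD U V : usc_pos U -> usc_pos V -> usc_pos (U \+ V).
Proof.
move=> uU uV x x0 e e0.
have e2 : 0 < e / 2 by rewrite divr_gt0.
have [d d0 Ud] := uU x x0 _ e2; have [d' d'0 Vd] := uV x x0 _ e2.
exists (Num.min d d') => [|y y0]; first by rewrite lt_min d0.
rewrite lt_min => /andP[yd yd'] /=.
by have := Ud y y0 yd; have := Vd y y0 yd'; lra.
Qed.

(* The superlevel sets [U > s - e] form a filter base; usc forces the value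
   [s] at any of its cluster points. *)
Lemma usc_attains_max U (p q M : R) : p <= q ->
  (forall x, p <= x <= q -> U x <= M) ->
  (forall x, p <= x <= q -> forall e : R, 0 < e -> exists2 d : R, 0 < d &
    forall y, p <= y <= q -> `|y - x| < d -> U y < U x + e) ->
  exists2 z, p <= z <= q & forall x, p <= x <= q -> U x <= U z.
Proof.
move=> pq bM uU.
pose A := [set U y | y in `[p, q]].
have hA : has_sup A.
  split; first by exists (U p), p => //=; rewrite in_itv/= lexx.
  by exists M => _ [y + <-]; rewrite /= in_itv/= => /bM.
pose B (e : R) : set R := [set y | p <= y <= q /\ sup A - e < U y].
pose G : set_system R := filter_from [set e : R | 0 < e] B.
have PG : ProperFilter G.
  apply: filter_from_proper; last first.
    move=> e e0; have [_ [y yp <-] ys] := sup_adherent e0 hA.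
    by exists y; split=> //; move: yp; rewrite /= in_itv.
  apply: filter_from_filter; first by exists 1; exact: ltr01.
  move=> e e' e0 e'0; exists (Num.min e e'); first by rewrite /= lt_min; apply/andP.
  move=> y [yp ys].
  have h1 : Num.min e e' <= e by rewrite ge_min lexx.
  have h2 : Num.min e e' <= e' by rewrite ge_min lexx orbT.
  by split; split=> //; lra.
have Gpq : G `[p, q]%classic.
  by exists 1; [exact: ltr01|move=> y [yp _]; rewrite /= in_itv].
have [z [zpq clz]] := @segment_compact R p q G PG Gpq.
move: zpq; rewrite /= in_itv/= => zpq; exists z => // x xpq.
apply: (@le_trans _ _ (sup A)).
  by apply: ub_le_sup; [have [] := hA|exists x; rewrite //= in_itv].
apply/ler_addgt0Pr => e e0.
have e2 : 0 < e / 2 by rewrite divr_gt0.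
have [d d0 Ud] := uU z zpq _ e2.
have GB : G (B (e / 2)) by exists (e / 2).
have [y [[ypq ys] /= yz]] := clz _ _ GB (nbhsx_ballx z d d0).
have := Ud y ypq; rewrite distrC => /(_ yz).
by lra.
Qed.

End Semicontinuity.

(** * The jump term, and the reduction of both viscosity notions to [subsol] *)

Section Subsolutions.
Context {R : realType}.
Variable F : cumulativeBounded (0:R) (1:R).
Implicit Types (U V phi f : R -> R) (x u : R).
Local Notation mu := (lebesgue_stieltjes_measure F).

Lemma measurable_posR : measurable (@posR R).
Proof. exact: measurable_itv. Qed.

Lemma posR_fin : (mu posR < +oo)%E.
Proof.
apply: (le_lt_trans (probability_le1 mu measurable_posR)).
by rewrite ltry.
Qed.

Lemma integrable_posR f (M : R) : measurable_fun posR f ->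
  (forall y, 0 < y -> `|f y| <= M) -> mu.-integrable posR (EFin \o f).
Proof.
move=> mf bf; apply: measurable_bounded_integrable => //.
- exact: measurable_posR.
- exact: posR_fin.
- exists M; split; first exact: num_real.
  move=> N MN y /=; rewrite /posR /= in_itv/= andbT => y0.
  exact: le_trans (bf _ y0) (ltW MN).
Qed.

Lemma test_fun_continuous phi x : test_fun phi -> 0 < x -> {for x, continuous phi}.
Proof.
by move=> [/(_ x) h _] /h [d _ _]; apply/differentiable_continuous/derivable1_diffP.
Qed.

Lemma test_fun_jet2 phi x : test_fun phi -> 0 < x ->
  jet2 phi (derive1 phi) (derive1n 2 phi) x.
Proof.
move=> [h _] x0; have [d d1 c2] := h x x0; split; last exact: c2.
- by apply: (DeriveDef d); rewrite derive1E.
- by apply: (DeriveDef d1); rewrite -derive1E.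
Qed.

Lemma measurable_test_fun_shift phi x : test_fun phi -> 0 < x ->
  measurable_fun posR (fun y => phi (x + y)).
Proof.
move=> tp x0; apply: open_continuous_measurable_fun; first exact: interval_open.
move=> y; rewrite inE /posR /= in_itv/= andbT => y0.
apply: (@continuous_comp _ _ _ (fun y => x + y) phi).
  exact: (cvgD (cvg_cst x) cvg_id).
by apply: test_fun_continuous => //; exact: addr_gt0.
Qed.

Definition jump phi x u : R := Rintegral mu posR (fun y => phi (x + y) - u).

Lemma jump_integrable phi x u : test_fun phi -> 0 < x ->
  mu.-integrable posR (EFin \o (fun y => phi (x + y) - u)).
Proof.
move=> tp x0; have [_ [_ [M bM]]] := tp.
apply: (@integrable_posR _ (M + `|u|)).
  by apply: measurable_funB => //; exact: measurable_test_fun_shift.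
move=> y y0; apply: (le_trans (ler_normB _ _)); apply: lerD => //.
by apply: bM; exact/ltW/addr_gt0.
Qed.

(** Jumps are positive, so only values to the right of [x] matter. This is what lets a larger test
    function replace a given one in the nonlocal term. *)
Lemma le_jump phi psi x u : test_fun phi -> test_fun psi -> 0 < x ->
  (forall y, x < y -> phi y <= psi y) -> jump phi x u <= jump psi x u.
Proof.
move=> tp tq x0 pq; apply: le_Rintegral.
- exact: measurable_posR.
- exact: jump_integrable.
- exact: jump_integrable.
- move=> y; rewrite /posR /= in_itv/= andbT => y0.
  by rewrite lerD2r pq// ltrDl.
Qed.

Variables lam c sigma a : R.

Definition diffgen (x d1 d2 : R) : R :=
  sigma ^+ 2 * x ^+ 2 / 2 * d2 + (a * x - c) * d1.

(* [U] satisfies the subsolution inequality tested at its own values rather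
   than at those of its upper envelope. *)
Definition subsol U : Prop := forall x phi, 0 < x -> test_fun phi -> U x = phi x ->
  (exists2 d : R, 0 < d & forall y, 0 <= y -> `|y - x| < d -> U y <= phi y) ->
  (forall y, x <= y -> U y <= phi y) ->
  0 <= diffgen x (derive1 phi x) (derive1n 2 phi x) + lam * jump phi x (phi x).

Lemma visc_sub_subsol U : bounded_pos U -> usc_pos U ->
  visc_sub lam c sigma a F U -> subsol U.
Proof.
move=> bU uU sU x phi x0 tp Ux [d d0 Ud] Ur; apply: sU => //.
- by rewrite upper_env_usc// ltW.
- by exists d => // y y0 yd; rewrite upper_env_usc// Ud.
- move=> y xy; rewrite upper_env_usc// ?Ur//.
  by apply: le_trans xy; exact: ltW.
Qed.

Lemma test_funN phi : test_fun phi -> test_fun (\- phi) /\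
  forall x, 0 < x -> derive1 (\- phi) x = - derive1 phi x /\
                     derive1n 2 (\- phi) x = - derive1n 2 phi x.
Proof.
move=> tp; have [h [cp [M bM]]] := tp.
have j x : 0 < x -> \forall y \near x,
    jet2 (\- phi) (fun y => - derive1 phi y) (fun y => - derive1n 2 phi y) y.
  move=> x0; near=> y.
  have y0 : 0 < y by near: y; exact: lt_nbhsr.
  have [d1 d2 c2] := test_fun_jet2 tp y0.
  by split; [exact: is_deriveN d1|exact: is_deriveN d2|exact: (cvgN c2)].
split.
  split; [|split].
  - by move=> x x0; have [] := near_jet2_derive (j x x0).
  - by move=> x; apply: continuousN; exact: cp.
  - by exists M => x x0; rewrite normrN bM.
by move=> x x0; have [] := near_jet2_derive (j x x0).
Unshelve. all: by end_near. Qed.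

Lemma jumpN phi x u : test_fun phi -> 0 < x -> jump (\- phi) x (- u) = - jump phi x u.
Proof.
move=> tp x0; apply: (etrans (y := -1 * jump phi x u)); last by rewrite mulN1r.
apply: etrans (@RintegralZl _ _ _ mu posR _ (-1) measurable_posR (jump_integrable u tp x0)).
by apply: eq_Rintegral => y _ /=; rewrite mulN1r opprB addrC opprK.
Qed.

(** If [phi] touches [- V] from above, then [- phi] touches [V] from below; negation preserves test
    functions and changes the sign of the operator. *)
Lemma visc_super_subsol V : bounded_pos V -> lsc_pos V ->
  visc_super lam c sigma a F V -> subsol (\- V).
Proof.
move=> bV lV sV x phi x0 tp Vx [d d0 Vd] Vr.
have lE y : 0 <= y -> lower_env V y = V y.
  move=> y0; rewrite lower_envN upper_env_usc ?opprK//.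
    exact: bounded_posN.
  exact: lsc_oppP.
have [tN /(_ x x0) [e1 e2]] := test_funN tp.
have : opL lam c sigma a F (\- phi) x <= 0.
  apply: (sV x (\- phi) x0 tN).
  - by rewrite lE ?(ltW x0)//= -Vx opprK.
  - by exists d => // y y0 yd; rewrite lE//= lerNl Vd.
  - move=> y xy; rewrite lE; last by apply: le_trans xy; exact: ltW.
    by rewrite /= lerNl; exact: Vr.
rewrite /opL e1 e2.
have -> : Rintegral mu posR (fun y => (\- phi) (x + y) - (\- phi) x) = - jump phi x (phi x).
  by rewrite -jumpN.
rewrite /diffgen -oppr_ge0; move: (jump _ _ _) => j h.
by apply: le_trans h _; rewrite le_eqVlt; apply/orP; left; apply/eqP; ring.
Qed.

End Subsolutions.

(** * Localized test functions and comparison on a segment *)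

Section LocalComparison.
Context {R : realType}.
Variables (F : cumulativeBounded (0:R) (1:R)) (lam c sigma a : R).
Hypothesis lam0 : 0 < lam.
Implicit Types (U h Phi f : R -> R) (x d : R).
Local Notation gen := (diffgen c sigma a).
Local Notation jump := (jump F).
Local Notation subsol := (subsol F lam c sigma a).

Lemma near_jet2_near_eq f g f1 f2 x : (\forall y \near x, f y = g y) ->
  (\forall y \near x, jet2 f f1 f2 y) -> \forall y \near x, jet2 g f1 f2 y.
Proof.
move=> fg jf; have fg2 : \forall y \near x, \forall z \near y, f z = g z by apply/near_join.
by apply: filterS2 fg2 jf => y; exact: jet2_near_eq.
Qed.

Lemma near_dist_lt x y d : `|y - x| < d -> \forall z \near y, `|z - x| < d.
Proof.
move=> yd; apply: (@cvgr_lt _ _ (nbhs y) _ (fun z : R => `|z - x|) `|y - x| _ d yd).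
apply: cvg_norm; apply: cvgB; [exact: cvg_id|exact: cvg_cst].
Qed.

Lemma near_dist_gt x y d : d < `|y - x| -> \forall z \near y, d < `|z - x|.
Proof.
move=> yd; apply: (@cvgr_gt _ _ (nbhs y) _ (fun z : R => `|z - x|) `|y - x| _ d yd).
apply: cvg_norm; apply: cvgB; [exact: cvg_id|exact: cvg_cst].
Qed.

(** The cutoff is the product of a step rising between [x - 2 * d] and [x - d] and its mirror image
    about [x]. *)
Lemma smooth_cutoff x d : 0 < d -> exists chi c1 c2 : R -> R,
  [/\ forall y, jet2 chi c1 c2 y,
      forall y, 0 <= chi y <= 1,
      forall y, `|y - x| <= d -> chi y = 1 &
      forall y, 2 * d <= `|y - x| -> chi y = 0].
Proof.
move=> d0.
have dn : d != 0 by rewrite gt_eqF.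
have [s1 [s2 js]] := step_jet2_affine d^-1 (2 - x / d).
have [t1 [t2 jt]] := step_jet2_affine (- d^-1) (2 + x / d).
eexists; eexists; eexists; split.
- by move=> y; exact: (jet2M (js y) (jt y)).
- by move=> y; rewrite /= mulr_ge0 ?mulr_ile1 ?step_ge0 ?step_le1.
- move=> y; rewrite ler_norml => /andP[y1 y2] /=.
  have -> : d^-1 * y + (2 - x / d) = (y - x) / d + 2 by field.
  have -> : - d^-1 * y + (2 + x / d) = (x - y) / d + 2 by field.
  rewrite !step_ge1 ?mulr1// -lerBlDr.
    by rewrite ler_pdivlMr//; lra.
  by rewrite ler_pdivlMr//; lra.
- move=> y; rewrite ler_normr => /orP[y1|y1] /=.
  + have -> : - d^-1 * y + (2 + x / d) = (x - y) / d + 2 by field.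
    rewrite [X in _ * X]step_le0 ?mulr0// -lerBrDr.
    by rewrite ler_pdivrMr//; lra.
  + have -> : d^-1 * y + (2 - x / d) = (y - x) / d + 2 by field.
    rewrite step_le0 ?mul0r// -lerBrDr.
    by rewrite ler_pdivrMr//; lra.
Qed.

(* The test function is [Phi + chi * (h - Phi)], with [chi] a cutoff
   supported where [U <= h < Phi]. *)
Lemma subsol_local U h h1 h2 Phi x : subsol U -> 0 < x ->
  (\forall y \near x, jet2 h h1 h2 y) -> U x = h x ->
  (\forall y \near x, U y <= h y) ->
  bounded_pos U -> test_fun Phi -> (forall y : R, 0 <= y -> U y < Phi y) ->
  0 <= gen x (h1 x) (h2 x) + lam * jump Phi x (U x).
Proof.
move=> sU x0 jh Ux Uh [B bB] tP UP.
have cP (y : R) : 0 < y -> {for y, continuous Phi} by exact: test_fun_continuous.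
(* Strictness of the majorant is used here: [h x = U x < Phi x] persists near [x] by continuity. *)
have hP : \forall y \near x, h y < Phi y.
  have ch := jet2_continuous (nbhs_singleton jh).
  have cd : Phi y - h y @[y --> x] --> Phi x - h x by exact: (cvgB (cP x x0) ch).
  have hp : 0 < Phi x - h x by rewrite subr_gt0 -Ux UP// ltW.
  by apply: filterS (cvgr_gt (Phi x - h x) cd 0 hp) => y; rewrite subr_gt0.
have xp : \forall y \near x, 0 < y by exact: lt_nbhsr.
have : \forall y \near x, [/\ jet2 h h1 h2 y, U y <= h y, h y < Phi y & 0 < y].
  by apply: filterS2 (filterI jh Uh) (filterI hP xp) => y [? ?] [? ?].
move=> [d3 /= d30 H].
have {}H y : `|y - x| < d3 -> [/\ jet2 h h1 h2 y, U y <= h y, h y < Phi y & 0 < y].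
  by move=> yd; apply: H; rewrite /= distrC.
(* With a third, the cutoff vanishes from radius [2 * d < d3] on. Jets of [h] are available within
   [d3], and any point at distance at least [d3] has a neighbourhood where [g] is zero, so [g] is
   C^2 everywhere on the positive axis. *)
pose d := d3 / 3; have d0 : 0 < d by rewrite /d divr_gt0.
have d3E : d3 = 3 * d by rewrite /d; field.
have [chi [c1 [c2 [jc c01 cin cout]]]] := smooth_cutoff x d0.
pose g := chi \* (h \+ (fun y => (-1) * Phi y)).
have jg (z : R) : exists g1 g2, \forall y \near z, jet2 g g1 g2 y.
  have [zd|zd] := ltP `|z - x| d3.
    eexists; eexists; apply: filterS (near_dist_lt zd) => y /H [jy _ _ y0].
    exact: (jet2M (jc y) (jet2D jy (jet2Z (-1) (test_fun_jet2 tP y0)))).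
  exists (cst 0), (cst 0).
  apply: (@near_jet2_near_eq (cst 0)); last by near=> y; exact: jet2_cst.
  have zd2 : 2 * d < `|z - x| by apply: lt_le_trans zd; rewrite d3E; lra.
  by apply: filterS (near_dist_gt zd2) => y yd; rewrite /g /= cout ?mul0r// ltW.
pose phi := Phi \+ g.
have phiE y : phi y = (1 - chi y) * Phi y + chi y * h y by rewrite /phi /g /=; ring.
have Uphi y : 0 <= y -> U y <= phi y <= Phi y.
  move=> y0; rewrite phiE; have /andP[q0 q1] := c01 y.
  have Uy := UP y y0.
  have [/H [_ hy1 hy2 _]|yd] := ltP `|y - x| d3; last first.
    by rewrite cout; [rewrite subr0 mul0r mul1r addr0 lexx ltW|lra].
  by apply/andP; split; nra.
have tphi : test_fun phi.
  split; [|split].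
  - move=> z z0; have [g1 [g2 jgz]] := jg z.
    have jpz : \forall y \near z, jet2 phi (derive1 Phi \+ g1) (derive1n 2 Phi \+ g2) y.
      have zp : \forall y \near z, 0 < y by exact: lt_nbhsr.
      apply: filterS2 jgz zp => y jy y0.
      exact: jet2D (test_fun_jet2 tP y0) jy.
    by have [] := near_jet2_derive jpz.
  - have cg : continuous g.
      move=> z; have [g1 [g2 jgz]] := jg z.
      exact: jet2_continuous (nbhs_singleton jgz).
    have [_ [cPhi _]] := tP.
    have cg' : {within `[0, +oo[, continuous g} by exact: continuous_subspaceT.
    by move=> z; exact: (cvgD (cPhi z) (cg' z)).
  - have [_ [_ [M bM]]] := tP.
    exists (B + M) => y y0; have /andP[l r] := Uphi y y0.
    have := bB y y0; have := bM y y0; rewrite !ler_norml => /andP[m1 m2] /andP[b1 b2].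
    have B0 : 0 <= B by lra.
    have M0 : 0 <= M by lra.
    by apply/andP; split; lra.
have jphi : \forall y \near x, jet2 phi h1 h2 y.
  apply: near_jet2_near_eq jh.
  have xd : `|x - x| < d by rewrite subrr normr0.
  by apply: filterS (near_dist_lt xd) => y yd; rewrite phiE cin ?ltW//; ring.
have [_ [e1 e2]] := near_jet2_derive jphi.
have phx : phi x = h x by rewrite phiE cin ?subrr ?normr0 ?ltW//; ring.
have := sU x phi x0 tphi; rewrite e1 e2 phx -Ux => /(_ erefl) sUx.
apply: (le_trans (sUx _ _)).
- by exists d => // y y0 _; have /andP[] := Uphi y y0.
- by move=> y xy; have /andP[] := Uphi y (le_trans (ltW x0) xy).
(* The derivatives at [x] are those of [h]; the jump term of [phi] is enlarged to that of [Phi]. *)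
rewrite lerD2l ler_pM2l//; apply: le_jump => // y xy.
by have /andP[] := Uphi y (le_trans (ltW x0) (ltW xy)).
Unshelve. all: by end_near. Qed.

(** At an interior positive maximum [z] of [U - h], a vertical translate of [h] touches [U] from
    above. The translation does not affect the strict inequality at [z]: [gen] sees only
    derivatives, and the jump term involves [Phi] and [U z] but not [h]. *)
Lemma subsol_comparison U h h1 h2 Phi (p q : R) : subsol U ->
  bounded_pos U -> usc_pos U -> test_fun Phi -> (forall y : R, 0 <= y -> U y < Phi y) ->
  0 < p -> p <= q ->
  (forall x, p <= x <= q -> \forall y \near x, jet2 h h1 h2 y) ->
  (forall x, p < x < q -> gen x (h1 x) (h2 x) + lam * jump Phi x (U x) < 0) ->
  U p <= h p -> U q <= h q -> forall x, p <= x <= q -> U x <= h x.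
Proof.
move=> sU bU uU tP UP p0 pq jh gh Up Uq x xpq.
have jh0 y : p <= y <= q -> jet2 h h1 h2 y by move=> /jh /nbhs_singleton.
have ch : {within `[p, q], continuous h}.
  apply: continuous_in_subspaceT => y; rewrite inE /= in_itv/= => /jh0.
  exact: jet2_continuous.
have [m _ hm] := EVT_min pq ch.
have [B bB] := bU.
have [z zpq zmax] : exists2 z, p <= z <= q &
    forall x, p <= x <= q -> U x - h x <= U z - h z.
  apply: (@usc_attains_max _ (fun y => U y - h y) p q (B - h m)) => //.
    move=> y ypq; have /andP[py _] := ypq.
    apply: lerB; last by apply: hm; rewrite in_itv.
    by apply: le_trans (ler_norm _) (bB _ _); exact: le_trans (ltW p0) py.
  move=> y ypq e e0; have /andP[py _] := ypq.
  have e2 : 0 < e / 2 by rewrite divr_gt0.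
  have [d d0 Ud] := uU y (le_trans (ltW p0) py) _ e2.
  have /cvgrPdist_lt /(_ _ e2) [d' /= d'0 hd] := jet2_continuous (jh0 y ypq).
  exists (Num.min d d') => [|t /andP[pt _]]; first by rewrite lt_min d0.
  rewrite lt_min => /andP[td td'].
  have := Ud t (le_trans (ltW p0) pt) td.
  have := hd t; rewrite /= distrC => /(_ td').
  by rewrite ltr_norml => /andP[]; lra.
rewrite leNgt; apply/negP => hx.
have mpos : 0 < U z - h z by have := zmax x xpq; lra.
have /andP[pz zq] := zpq.
have zp : z != p by apply/eqP => zp; move: mpos; rewrite zp; lra.
have zq' : z != q by apply/eqP => zp'; move: mpos; rewrite zp'; lra.
have zpq' : p < z < q by rewrite !lt_neqAle eq_sym zp zq' pz zq.
have z0 : 0 < z by exact: lt_le_trans pz.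
have jz : \forall y \near z, jet2 (h \+ cst (U z - h z)) (h1 \+ cst 0) (h2 \+ cst 0) y.
  by apply: filterS (jh z zpq) => y jy; exact: jet2D jy (jet2_cst _ y).
have Uz : U z = (h \+ cst (U z - h z)) z by rewrite /= addrC subrK.
have Un : \forall y \near z, U y <= (h \+ cst (U z - h z)) y.
  have zn : \forall y \near z, p < y < q.
    by apply: filterS2 (lt_nbhsr (andP zpq').1) (lt_nbhsl (andP zpq').2) => y -> ->.
  apply: filterS zn => y /andP[py yq]; have := zmax y.
  by rewrite (ltW py) (ltW yq) => /(_ isT) /=; lra.
have := subsol_local sU z0 jz Uz Un bU tP UP.
by rewrite /= !addr0 leNgt gh.
Qed.

End LocalComparison.

(** * The scale function of the diffusion and chord inequalities *)

Section ScaleFunction.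
Context {R : realType}.
Variables (F : cumulativeBounded (0:R) (1:R)) (lam c sigma a : R).
Hypotheses (lam0 : 0 < lam) (sigma0 : 0 < sigma).
Implicit Types (U h Phi f s : R -> R) (x d k : R).
Local Notation gen := (diffgen c sigma a).
Local Notation jump := (jump F).
Local Notation subsol := (subsol F lam c sigma a).

(** Confined to the right of [p], because the construction integrates [s1] from a base point that
    must avoid the singularity at 0. *)
Definition is_scale s (p : R) : Prop := exists s1 s2, forall x, p < x ->
  [/\ jet2 s s1 s2 x, 0 < s1 x & gen x (s1 x) (s2 x) = 0].

Lemma primitive f (p : R) : (forall x, p <= x -> {for x, continuous f}) ->
  exists g, forall x, p < x -> is_derive x 1 g (f x).
Proof.
move=> cf; exists (fun x => \int[lebesgue_measure]_(t in `[p, x]) f t)%R => x px.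
have x1 : x < x + 1 by rewrite ltrDl.
have fi : lebesgue_measure.-integrable `[p, x + 1] (EFin \o f).
  apply: continuous_compact_integrable; first exact: segment_compact.
  apply: continuous_in_subspaceT => y; rewrite inE /= in_itv/= => /andP[py _].
  exact: cf.
have [d e] := continuous_FTC1_closed x1 fi px (cf x (ltW px)).
by apply: (DeriveDef d); rewrite -derive1E.
Qed.

Lemma scale_exists (p : R) : 0 < p -> exists s, is_scale s p.
Proof.
move=> p0.
(* The logarithm of the scale density: [gen] vanishes on [s] when [s1 = expR b] with
   [b1 x = - 2 (a x - c) / (sigma^2 x^2)]. *)
pose b (x : R) := - (2 * a / sigma ^+ 2) * ln x - 2 * c / sigma ^+ 2 * x^-1.
pose b1 (x : R) := - (2 * a / sigma ^+ 2) * x^-1 + 2 * c / sigma ^+ 2 * x ^- 2.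
have db x : 0 < x -> is_derive x 1 b (b1 x).
  move=> x0; have xn : x != 0 by rewrite gt_eqF.
  have dV : is_derive x 1 (fun y : R => y^-1) (- x ^- 2).
    by apply: (is_derive_eq (is_deriveV xn (is_derive_id x 1))); rewrite /GRing.scale/= mulr1.
  apply: (is_derive_eq (is_deriveB (is_deriveZ (- (2 * a / sigma ^+ 2)) (is_derive1_ln x0))
    (is_deriveZ (2 * c / sigma ^+ 2) dV))).
  by rewrite /b1 /GRing.scale/=; ring.
have ds1 x : 0 < x -> is_derive x 1 (fun y => expR (b y)) (expR (b x) * b1 x).
  by move=> x0; exact: (is_derive1_comp (is_derive_expR (b x)) (db x x0)).
have cs1 x : 0 < x -> {for x, continuous (fun y => expR (b y))}.
  by move=> /ds1 /is_derive_continuous.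
have [s ds] := @primitive (fun y => expR (b y)) p (fun x px => cs1 x (lt_le_trans p0 px)).
exists s, (fun y => expR (b y)), (fun y => expR (b y) * b1 y) => x px.
have x0 := lt_trans p0 px; have xn : x != 0 by rewrite gt_eqF.
have sn : sigma != 0 by rewrite gt_eqF.
split; last 2 first.
- exact: expR_gt0.
- by rewrite /diffgen /b1; field; rewrite xn sn.
split; [exact: ds|exact: ds1|].
apply: cvgM; first exact: cs1.
have cV : {for x, continuous (fun y : R => y^-1)} by apply: (cvgV xn); exact: cvg_id.
have cV2 : {for x, continuous (fun y : R => y ^- 2)}.
  apply: (@cvgV _ _ (nbhs x) _ (fun y : R => y ^+ 2) (x ^+ 2)); first by rewrite expf_neq0.
  exact: exprn_continuous.
exact: (cvgD (cvgM (cvg_cst _) cV) (cvgM (cvg_cst _) cV2)).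
Qed.

Lemma scale_lt s (p x y : R) : is_scale s p -> p < x -> x < y -> s x < s y.
Proof.
move=> [s1 [s2 js]] px xy.
have dv t : p < t -> is_derive t 1 s (s1 t) by move=> /js [[]].
have [||t] := MVT (f := s) (df := s1) xy.
- by move=> t; rewrite in_itv/= => /andP[xt _]; apply: dv; exact: lt_trans xt.
- apply: continuous_in_subspaceT => t; rewrite inE /= in_itv/= => /andP[xt _].
  by apply: is_derive_continuous (dv t _); exact: lt_le_trans xt.
rewrite in_itv/= => /andP[xt _] sE.
have [_ s1t _] := js t (lt_trans px xt).
by rewrite -subr_gt0 sE mulr_gt0// subr_gt0.
Qed.

Lemma is_scale_continuous s (p x : R) : is_scale s p -> p < x -> {for x, continuous s}.
Proof. by move=> [s1 [s2 js]] /js [/jet2_continuous]. Qed.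

(* The comparison function is the chord in the scale [s] corrected by
   [k (x - x0)^2]. *)
Lemma subsol_chord U s Phi (p x0 z e k : R) : subsol U ->
  bounded_pos U -> usc_pos U -> test_fun Phi -> (forall y : R, 0 <= y -> U y < Phi y) ->
  is_scale s p -> 0 < p -> p < z -> z < x0 -> x0 < e ->
  (forall x, z < x < e -> k * gen x (2 * (x - x0)) 2 + lam * jump Phi x (U x) < 0) ->
  (s e - s z) * U x0 <= (s e - s x0) * (U z - k * (z - x0) ^+ 2)
                        + (s x0 - s z) * (U e - k * (e - x0) ^+ 2).
Proof.
move=> sU bU uU tP UP ss p0 pz zx xe neg.
have px := lt_trans pz zx; have ze := lt_trans zx xe.
have sze : 0 < s e - s z by rewrite subr_gt0; exact: scale_lt pz ze.
have sn : s e - s z != 0 by rewrite gt_eqF.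
(* Endpoint values of [U] with the correction removed; the slope [be] in the scale [s] then makes
   [h] agree with [U] at [z] and [e]. *)
pose A := U z - k * (z - x0) ^+ 2; pose B := U e - k * (e - x0) ^+ 2.
pose be := (B - A) / (s e - s z).
have [s1 [s2 js]] := ss.
pose h := cst (A - be * s z) \+ ((fun y => be * s y) \+
  (fun y => k * ((id \+ cst (- x0)) \* (id \+ cst (- x0))) y)).
have jh y : p < y -> jet2 h (fun y => be * s1 y + k * (2 * (y - x0)))
    (fun y => be * s2 y + k * 2) y.
  move=> /js [jy _ _].
  have jq := jet2D (jet2_id y) (jet2_cst (- x0) y).
  have jj := jet2D (jet2_cst (A - be * s z) y) (jet2D (jet2Z be jy) (jet2Z k (jet2M jq jq))).
  have e1 := jet2_eq_jets jj; apply: e1 => t /=; ring.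
have hz : h z = U z by rewrite /h /A /=; ring.
have he : h e = U e by rewrite /h /be /A /B /=; field.
have hx : h x0 = (A - be * s z) + be * s x0 by rewrite /h /=; ring.
have : U x0 <= h x0.
  apply: (@subsol_comparison _ _ _ _ _ _ lam0 U h _ _ Phi z e sU bU uU tP UP).
  - exact: lt_trans pz.
  - exact: ltW.
  - move=> x /andP[zx' _]; have px' := lt_le_trans pz zx'.
    by apply: filterS (lt_nbhsr px') => y; exact: jh.
  - move=> x /andP[zx' xe']; have [_ _ g0] := js x (lt_trans pz zx').
    have := neg x; rewrite zx' xe' => /(_ isT); apply: le_lt_trans.
    rewrite lerD2r /diffgen; move: g0; rewrite /diffgen => g0.
    rewrite le_eqVlt; apply/orP; left; apply/eqP.
    transitivity (be * (sigma ^+ 2 * x ^+ 2 / 2 * s2 x + (a * x - c) * s1 x) +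
      k * (sigma ^+ 2 * x ^+ 2 / 2 * 2 + (a * x - c) * (2 * (x - x0)))).
      by ring.
    by rewrite g0; ring.
  - by rewrite hz.
  - by rewrite he.
  - by rewrite !ltW.
rewrite hx -(ler_pM2l sze) => /le_trans; apply.
rewrite le_eqVlt; apply/orP; left; apply/eqP.
by rewrite -/A -/B /be; field.
Qed.

End ScaleFunction.

(** * Persistence of strict inequalities near a point *)

Section LocalWindow.
Context {R : realType}.
Variables (F : cumulativeBounded (0:R) (1:R)) (lam c sigma a : R).
Hypotheses (lam0 : 0 < lam) (sigma0 : 0 < sigma).
Implicit Types (U Phi s : R -> R) (x d k : R).
Local Notation gen := (diffgen c sigma a).
Local Notation jump := (jump F).
Local Notation subsol := (subsol F lam c sigma a).
Local Notation mu := (lebesgue_stieltjes_measure F).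

Definition mass : R := fine (mu posR).

Lemma mass_ge0 : 0 <= mass.
Proof. exact: fine_ge0. Qed.

Lemma mass_le1 : mass <= 1.
Proof.
rewrite -lee_fin /mass fineK; first exact: (probability_le1 mu measurable_posR).
by rewrite ge0_fin_numE//; exact: posR_fin.
Qed.

Lemma cst_integrable_posR (u : R) : mu.-integrable posR (EFin \o (cst u)).
Proof. by apply: (@integrable_posR _ _ _ `|u|) => //; exact: measurable_cst. Qed.

Lemma jumpE Phi x (u : R) : test_fun Phi -> 0 < x ->
  jump Phi x u = jump Phi x 0 - u * mass.
Proof.
move=> tP x0.
have h1 := @RintegralB _ _ _ mu posR _ _ measurable_posR
  (jump_integrable F 0 tP x0) (cst_integrable_posR u).
apply: etrans (etrans h1 _).
  by apply: eq_Rintegral => y _; rewrite /= subr0.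
by congr (_ - _); exact: (@Rintegral_cst _ _ _ mu posR measurable_posR u).
Qed.

Lemma test_fun_cst (k : R) : test_fun (cst k).
Proof.
split; [|split].
- move=> x _; have j : \forall y \near x, jet2 (cst k) (cst 0) (cst 0) y.
    by near=> y; exact: jet2_cst.
  by have [] := near_jet2_derive j.
- by apply: continuous_subspaceT => x; exact: cvg_cst.
- by exists `|k|.
Unshelve. all: by end_near. Qed.

Lemma jump_cst k x (u : R) : jump (cst k) x u = (k - u) * mass.
Proof. exact: (@Rintegral_cst _ _ _ mu posR measurable_posR (k - u)). Qed.

(** Dominated convergence with a constant bound. The level [u] is frozen, since continuity could not
    be claimed with [U y] in its place. *)
Lemma jump_continuous Phi x (u : R) : test_fun Phi -> 0 < x ->
  {for x, continuous (fun y => jump Phi y u)}.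
Proof.
move=> tP x0; have [_ [_ [M bM]]] := tP.
have xi : x \in `]0, x + 1[%classic.
  by apply/mem_set; rewrite /= in_itv/= x0/= ltrDl.
have := @continuity_under_integral R _ _ mu (fun x y => Phi (x + y) - u) posR
  measurable_posR 0 (x + 1) _ _ (cst (M + `|u|)) (cst_integrable_posR _) _ x xi.
apply.
- move=> y; rewrite /= in_itv/= => /andP[y0 _]; exact: jump_integrable.
- apply: aeW => y; rewrite /posR /= in_itv/= andbT => y0 z.
  rewrite inE /= in_itv/= => /andP[z0 _].
  apply: cvgB; last exact: cvg_cst.
  apply: (@continuous_comp _ _ _ (fun z => z + y) Phi).
    exact: (cvgD cvg_id (cvg_cst y)).
  by apply: test_fun_continuous => //; exact: addr_gt0.
- move=> y; rewrite /= in_itv/= => /andP[y0 _]; apply: aeW => z.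
  rewrite /posR /= in_itv/= andbT => z0.
  apply: (le_trans (ler_normB _ _)); rewrite lerD2r bM//.
  by rewrite ltW// addr_gt0.
Qed.

Lemma sq_gen_continuous (x0 : R) : continuous (fun x => gen x (2 * (x - x0)) 2).
Proof.
move=> x; rewrite /diffgen.
have cx : (fun y : R => y) @ x --> x by exact: cvg_id.
apply: cvgD; apply: cvgM.
- apply: cvgM; last exact: cvg_cst.
  by apply: cvgM; [exact: cvg_cst|exact: exprn_continuous].
- exact: cvg_cst.
- by apply: cvgB; [apply: cvgM => //; exact: cvg_cst|exact: cvg_cst].
- apply: cvgM; first exact: cvg_cst.
  by apply: cvgB => //; exact: cvg_cst.
Qed.

Lemma sq_gen_center (x0 : R) : gen x0 (2 * (x0 - x0)) 2 = sigma ^+ 2 * x0 ^+ 2.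
Proof. by rewrite /diffgen subrr; field. Qed.

Lemma sq_gen_center_gt0 (x0 : R) : 0 < x0 -> 0 < sigma ^+ 2 * x0 ^+ 2.
Proof. by move=> x0p; rewrite mulr_gt0// exprn_gt0. Qed.

(** In a chord through [x0], [d] is the scale distance from [x0] to the moving end [y] and [A] the
    one to the fixed end. Dividing by [A] bounds [U0 - Uy] by [Q] plus a term of order [d / A],
    small because [A] stays above [S]. *)
Lemma chord_lower_bound (A d U0 Uy Ue Q k C S e : R) :
  0 < S -> S <= A -> 0 <= d -> 0 < e ->
  (A + d) * U0 <= A * (Uy + Q) + d * (Ue + k) -> Ue - U0 + k <= C ->
  d * C < S * (e / 2) -> Q < e / 2 -> U0 - e < Uy.
Proof.
move=> S0 SA d0 e0 H kC dC Qe.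
have A0 : 0 < A by exact: lt_le_trans SA.
have h1 : d * (Ue - U0 + k) <= d * C by rewrite ler_wpM2l.
have h2 : S * (e / 2) <= A * (e / 2) by rewrite ler_wpM2r// divr_ge0 ?ltW.
have h3 : A * Q < A * (e / 2) by rewrite ltr_pM2l.
have : A * (U0 - Uy) < A * e by nra.
by rewrite ltr_pM2l//; lra.
Qed.

(* Chords with one endpoint tending to [x0], against a constant majorant. *)
Lemma subsol_lsc U (x0 : R) : subsol U -> bounded_pos U -> usc_pos U -> 0 < x0 ->
  forall e : R, 0 < e -> \forall y \near x0, U x0 - e < U y.
Proof.
move=> sU bU uU x0p e e0; have [B0 bB0] := bU.
(* The extra 1 makes the constant [B] a strict majorant of [U]. *)
pose B := `|B0| + 1.
have B0p : 0 < B by rewrite /B ltr_pwDr.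
have bB x : 0 <= x -> - B < U x < B.
  move=> x_ge0; rewrite -ltr_norml; apply: (le_lt_trans (bB0 x x_ge0)).
  by rewrite /B (le_lt_trans (ler_norm _))// ltrDl.
have UB y : 0 <= y -> U y < cst B y by move=> /bB /andP[].
pose D0 := sigma ^+ 2 * x0 ^+ 2.
have D0p : 0 < D0 by exact: sq_gen_center_gt0.
have p0 : 0 < x0 / 2 by rewrite divr_gt0.
have [s ss] := scale_exists c a sigma0 p0.
(* Near [x0], [gen] of the square exceeds [D0 / 2], so [K] times it exceeds [lam * (2 * B) + 1],
   while the jump term is at most [lam * (2 * B)]. *)
pose K := 2 * (lam * (2 * B) + 1) / D0.
have Kp : 0 < K by rewrite /K divr_gt0// mulr_gt0// addr_gt0// !mulr_gt0.
have nD : \forall y \near x0, D0 / 2 < gen y (2 * (y - x0)) 2.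
  apply: (@cvgr_gt _ _ (nbhs x0) _ (fun y => gen y (2 * (y - x0)) 2) (gen x0 (2 * (x0 - x0)) 2)).
    exact: sq_gen_continuous.
  by rewrite sq_gen_center -/D0; lra.
have xp : \forall y \near x0, x0 / 2 < y by apply: lt_nbhsr; lra.
have [r2 /= r20 Hr] := filterI nD xp.
pose r := r2 / 2; have rp : 0 < r by rewrite /r divr_gt0.
have {}Hr y : `|y - x0| < r2 -> D0 / 2 < gen y (2 * (y - x0)) 2 /\ x0 / 2 < y.
  by move=> yr; apply: Hr; rewrite /= distrC.
have rr : r < r2 by rewrite /r; lra.
have neg x : `|x - x0| < r2 ->
    - K * gen x (2 * (x - x0)) 2 + lam * jump (cst B) x (U x) < 0.
  move=> xr; have [gD xp2] := Hr x xr.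
  have /andP[U1 U2] : - B < U x < B by apply: bB; lra.
  have KD : K * (D0 / 2) = lam * (2 * B) + 1 by rewrite /K; field; rewrite gt_eqF.
  have Kg : K * (D0 / 2) < K * gen x (2 * (x - x0)) 2 by rewrite ltr_pM2l.
  have jl : jump (cst B) x (U x) <= 2 * B.
    rewrite jump_cst; have := mass_le1; have := mass_ge0 => m0 m1.
    by nra.
  have ll : lam * jump (cst B) x (U x) <= lam * (2 * B) by rewrite ler_pM2l.
  by lra.
have x0h : x0 / 2 < x0 by lra.
have [_ zl] := Hr (x0 - r) ltac:(by rewrite addrAC subrr add0r normrN gtr0_norm).
pose C := 2 * B + K * r ^+ 2.
have Cp : 0 < C by rewrite /C addr_gt0// mulr_gt0// exprn_gt0.
(* The fixed end is [x0 + r] when [y] lies left of [x0] and [x0 - r] when it lies right; the minimum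
   serves both cases. *)
pose S := Num.min (s (x0 + r) - s x0) (s x0 - s (x0 - r)).
have Sp : 0 < S.
  rewrite lt_min !subr_gt0; apply/andP; split; apply: (scale_lt ss) => //; lra.
have nG : \forall y \near x0, `|s y - s x0| * C < S * (e / 2) /\ K * (y - x0) ^+ 2 < e / 2.
  have cs : {for x0, continuous s} by exact: is_scale_continuous ss x0h.
  apply: filterI.
    apply: (@cvgr_lt _ _ (nbhs x0) _ (fun y => `|s y - s x0| * C) (`|s x0 - s x0| * C)).
      apply: cvgM; last exact: cvg_cst.
      by apply: cvg_norm; apply: cvgB => //; exact: cvg_cst.
    by rewrite subrr normr0 mul0r mulr_gt0// divr_gt0.
  apply: (@cvgr_lt _ _ (nbhs x0) _ (fun y => K * (y - x0) ^+ 2) (K * (x0 - x0) ^+ 2)).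
    apply: cvgM; first exact: cvg_cst.
    apply: (@continuous_comp _ _ _ (fun y => y - x0) (fun t => t ^+ 2)).
      by apply: cvgB; [exact: cvg_id|exact: cvg_cst].
    exact: exprn_continuous.
  by rewrite subrr expr0n mulr0 divr_gt0.
have nr : \forall y \near x0, `|y - x0| < r by apply: near_dist_lt; rewrite subrr normr0.
apply: filterS2 nG nr => y [y1 y2] yr.
have yr2 := lt_trans yr rr.
have [_ yh] := Hr y yr2.
have tB := test_fun_cst B.
have U0 := bB x0 (ltW x0p).
move: yr; rewrite ltr_norml => /andP[yl yu].
have /andP[U1 U2] := U0.
have xr : x0 < x0 + r by rewrite ltrDl.
have xl : x0 - r < x0 by rewrite gtrBl.
have inw t : x0 - r <= t <= x0 + r -> `|t - x0| < r2.
  by move=> /andP[t1 t2]; rewrite ltr_norml; apply/andP; split; lra.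
have [yx|yx|->] := ltgtP y x0; last by lra.
- have SE : S <= s (x0 + r) - s x0 by rewrite ge_min lexx.
  have ch : (s (x0 + r) - s y) * U x0 <= (s (x0 + r) - s x0) * (U y - - K * (y - x0) ^+ 2)
                        + (s x0 - s y) * (U (x0 + r) - - K * (x0 + r - x0) ^+ 2).
    apply: (subsol_chord lam0 sU bU uU tB UB ss p0 yh yx xr) => t /andP[t1 t2].
    by apply/neg/inw/andP; split; lra.
  have sy : s y < s x0 by exact: scale_lt ss yh yx.
  rewrite ltr0_norm ?subr_lt0// opprB in y1.
  have /andP[V1 V2] : - B < U (x0 + r) < B by apply: bB; lra.
  apply: (@chord_lower_bound _ _ _ _ (U (x0 + r)) _ (K * r ^+ 2) _ _ _ Sp SE _ e0 _ _ y1 y2).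
  + by rewrite subr_ge0 ltW.
  + by move: ch; lra.
  + by rewrite /C; lra.
- have SE : S <= s x0 - s (x0 - r) by rewrite ge_min lexx orbT.
  have ch : (s y - s (x0 - r)) * U x0 <= (s y - s x0) * (U (x0 - r) - - K * (x0 - r - x0) ^+ 2)
                        + (s x0 - s (x0 - r)) * (U y - - K * (y - x0) ^+ 2).
    apply: (subsol_chord lam0 sU bU uU tB UB ss p0 zl xl yx) => t /andP[t1 t2].
    by apply/neg/inw/andP; split; lra.
  have sy : s x0 < s y by exact: scale_lt ss x0h yx.
  rewrite gtr0_norm ?subr_gt0// in y1.
  have /andP[V1 V2] : - B < U (x0 - r) < B by apply: bB; lra.
  apply: (@chord_lower_bound _ _ _ _ (U (x0 - r)) _ (K * r ^+ 2) _ _ _ Sp SE _ e0 _ _ y1 y2).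
  + by rewrite subr_ge0 ltW.
  + by move: ch; lra.
  + by rewrite /C; lra.
Qed.

(** The jump term grows only when [U x] drops below [U x0], and [subsol_lsc] limits this drop; with
    the level frozen at [U x0], everything is continuous in [x]. *)
Lemma subsol_window U Phi (x0 k : R) : subsol U -> bounded_pos U -> usc_pos U ->
  test_fun Phi -> 0 < x0 ->
  k * (sigma ^+ 2 * x0 ^+ 2) + lam * jump Phi x0 (U x0) < 0 ->
  \forall x \near x0, k * gen x (2 * (x - x0)) 2 + lam * jump Phi x (U x) < 0.
Proof.
move=> sU bU uU tP x0p neg.
pose g := - (k * (sigma ^+ 2 * x0 ^+ 2) + lam * jump Phi x0 (U x0)).
have g0 : 0 < g by rewrite oppr_gt0.
have n1 : \forall x \near x0, k * gen x (2 * (x - x0)) 2 + lam * jump Phi x (U x0) < - (g / 2).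
  apply: (@cvgr_lt _ _ (nbhs x0) _ (fun x => k * gen x (2 * (x - x0)) 2 + lam * jump Phi x (U x0))
    (k * gen x0 (2 * (x0 - x0)) 2 + lam * jump Phi x0 (U x0))).
    apply: cvgD; apply: cvgM; [exact: cvg_cst|exact: sq_gen_continuous|exact: cvg_cst|].
    exact: jump_continuous.
  by rewrite sq_gen_center -[ltLHS]opprK -/g; lra.
(* Half of the gap [g] went to continuity in [x]; this tolerance, multiplied by [lam] and by a mass
   at most 1, spends no more than the other half. *)
have e0 : 0 < g / (2 * lam) by rewrite divr_gt0// mulr_gt0.
have n2 := subsol_lsc sU bU uU x0p e0.
apply: filterS2 (filterI n1 n2) (lt_nbhsr x0p) => x [x1 x2] xp.
have jE : jump Phi x (U x) = jump Phi x (U x0) + (U x0 - U x) * mass.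
  by rewrite (jumpE (U x))// (jumpE (U x0))//; ring.
have lE : lam * (g / (2 * lam)) = g / 2 by field; rewrite gt_eqF.
have m1 : (U x0 - U x) * mass <= g / (2 * lam).
  apply: (@le_trans _ _ (g / (2 * lam) * mass)).
    by rewrite ler_wpM2r ?mass_ge0//; move: x2; rewrite ltrBlDr -ltrBlDl => /ltW.
  by rewrite ler_piMr ?mass_le1// ltW.
have m2 : lam * ((U x0 - U x) * mass) <= g / 2 by rewrite -lE ler_pM2l.
by rewrite jE [lam * _]mulrDr addrA; apply: (lt_le_trans (ltr_leD x1 m2)); rewrite addNr.
Qed.

End LocalWindow.

(** * C^2 majorants decreasing the gap to a bounded upper semicontinuous function pointwise to
    zero *)

Section Majorants.
Context {R : realType}.
Implicit Types (U : R -> R) (M : nat -> R) (b x t : R).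

(** A C^2 interpolation of the values [M j] at the knots [j / b], constant after [K / b]: each step
    adds one increment and is flat outside its own grid interval. *)
Fixpoint staircase M b (K : nat) x : R :=
  if K is k.+1 then staircase M b k x + (M k.+1 - M k) * step (b * x - k%:R)
  else M 0%N.

Lemma staircase_jet2 M b K : exists p1 p2, forall x, jet2 (staircase M b K) p1 p2 x.
Proof.
elim: K => [|K [p1 [p2 ih]]].
  by exists (cst 0), (cst 0) => x; exact: jet2_cst.
have [s1 [s2 js]] := step_jet2_affine b (- K%:R).
by eexists; eexists => x; exact: (jet2D (ih x) (jet2Z (M K.+1 - M K) (js x))).
Qed.

Lemma staircase_right M b K x : K%:R <= b * x -> staircase M b K x = M K.
Proof.
elim: K => [//|K ih] Kx /=; rewrite ih; last by apply: le_trans Kx; rewrite ler_nat.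
rewrite step_ge1; first by rewrite mulr1 addrC subrK.
by move: Kx; rewrite -natr1; lra.
Qed.

Lemma staircase_mid M b K i x : (i < K)%N -> i%:R <= b * x <= i.+1%:R ->
  staircase M b K x = M i + (M i.+1 - M i) * step (b * x - i%:R).
Proof.
elim: K => [//|K ih] iK ix /=; have /andP[ix1 ix2] := ix.
move: iK; rewrite ltnS leq_eqVlt => /orP[/eqP <-|iK].
  by rewrite staircase_right.
rewrite ih// [step (b * x - K%:R)]step_le0 ?mulr0 ?addr0//.
by rewrite subr_le0 (le_trans ix2)// ler_nat.
Qed.

Lemma staircase_between M b K x : 0 <= b * x ->
  (exists2 t, 0 <= t <= 1 & exists2 i, (i < K)%N & i%:R <= b * x <= i.+1%:R /\
     staircase M b K x = (1 - t) * M i + t * M i.+1) \/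
  staircase M b K x = M K /\ K%:R <= b * x.
Proof.
move=> bx; have [Kx|xK] := leP K%:R (b * x).
  by right; split=> //; exact: staircase_right.
left; have /andP[t1 t2] := truncn_itv bx.
pose i := Num.truncn (b * x).
have iK : (i < K)%N by rewrite -(ltr_nat R); exact: le_lt_trans t1 xK.
have ix : i%:R <= b * x <= i.+1%:R by rewrite t1 ltW.
exists (step (b * x - i%:R)); first by rewrite step_ge0 step_le1.
by exists i => //; split=> //; rewrite (staircase_mid M iK ix); ring.
Qed.

Lemma test_fun_staircase M b K (C : R) : 0 <= b -> (forall j, `|M j| <= C) ->
  test_fun (staircase M b K) /\ forall x, 0 <= x -> `|staircase M b K x| <= C.
Proof.
move=> b0 MC.
have bnd x : 0 <= x -> `|staircase M b K x| <= C.
  move=> x0; have [[t /andP[t0 t1] [i _ [_ ->]]]|[-> _//]] := staircase_between M K (mulr_ge0 b0 x0).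
  apply: (le_trans (ler_normD _ _)); rewrite !normrM (ger0_norm t0) ger0_norm ?subr_ge0//.
  apply: (@le_trans _ _ ((1 - t) * C + t * C)); last by rewrite -mulrDl subrK mul1r.
  by apply: lerD; rewrite ler_wpM2l// subr_ge0.
split=> //; have [p1 [p2 jp]] := staircase_jet2 M b K.
split; [|split].
- move=> x _; have j : \forall y \near x, jet2 (staircase M b K) p1 p2 y.
    by near=> y; exact: jp.
  by have [] := near_jet2_derive j.
- by apply: continuous_subspaceT => x; exact: jet2_continuous (jp x).
- by exists C.
Unshelve. all: by end_near. Qed.

(** Both grid intervals adjacent to the knot [j / b] are taken, so that on any grid interval the
    values at its two ends, hence their convex combinations, dominate [U]. *)
Definition cell U b (j : nat) : set R :=
  [set U y | y in [set y : R | 0 <= y /\ `|b * y - j%:R| <= 1]].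

(** The added [b^-1] makes the bound strict yet vanishes with the mesh. From index [K] on a global
    bound is used, since the last value of the staircase must dominate [U] on the whole half-line to
    the right. *)
Definition cell_bound U (B b : R) (K j : nat) : R :=
  if (j < K)%N then sup (cell U b j) + b^-1 else B + 1.

Lemma cell_has_sup U B b j : 0 < b -> (forall x, 0 <= x -> `|U x| <= B) ->
  has_sup (cell U b j).
Proof.
move=> b0 bB; split.
  exists (U (j%:R / b)), (j%:R / b) => //=; split; first by rewrite divr_ge0// ltW.
  by rewrite mulrC divfK ?gt_eqF// subrr normr0.
by exists B => _ [y [y0 _] <-]; exact: le_trans (ler_norm _) (bB _ y0).
Qed.

Lemma cell_bound_gt U B b K j x : 0 < b -> (forall x, 0 <= x -> `|U x| <= B) ->
  0 <= x -> `|b * x - j%:R| <= 1 -> U x < cell_bound U B b K j.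
Proof.
move=> b0 bB x0 xj; rewrite /cell_bound; case: ifP => _.
  apply: (@le_lt_trans _ _ (sup (cell U b j))); last by rewrite ltrDl invr_gt0.
  by apply: ub_le_sup; [have [] := cell_has_sup j b0 bB|exists x].
by apply: (@le_lt_trans _ _ B); [exact: le_trans (ler_norm _) (bB _ x0)|rewrite ltrDl].
Qed.

Lemma cell_bound_norm U B b K j : 1 <= b -> (forall x, 0 <= x -> `|U x| <= B) ->
  `|cell_bound U B b K j| <= B + 1.
Proof.
move=> b1 bB; have b0 : 0 < b by exact: lt_le_trans b1.
have bV1 : b^-1 <= 1 by rewrite invf_le1.
have bV0 : 0 < b^-1 by rewrite invr_gt0.
have B0 : 0 <= B by exact: le_trans (normr_ge0 _) (bB 0 (lexx _)).
rewrite /cell_bound; case: ifP => _; last by rewrite ger0_norm ?addr_ge0.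
have hs := cell_has_sup j b0 bB.
have s1 : sup (cell U b j) <= B.
  apply: ge_sup; first by have [] := hs.
  by move=> _ [y [y0 _] <-]; exact: le_trans (ler_norm _) (bB _ y0).
have s2 : - B <= sup (cell U b j).
  have [[v vj] hub] := hs; apply: (@le_trans _ _ v); last exact: ub_le_sup.
  by move: vj => [y [y0 _] <-]; have := bB y y0; rewrite ler_norml => /andP[].
by rewrite ler_norml; apply/andP; split; lra.
Qed.

(** Two points within [1 / b] of the same knot are at most [2 / b] apart, so the cell lies where
    semicontinuity at [x] controls [U]. *)
Lemma cell_bound_le U B b K j x (d e : R) : 0 < b -> (forall x, 0 <= x -> `|U x| <= B) ->
  `|b * x - j%:R| <= 1 -> (j < K)%N -> 2 / b < d ->
  (forall y, 0 <= y -> `|y - x| < d -> U y < U x + e) ->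
  cell_bound U B b K j <= U x + e + b^-1.
Proof.
move=> b0 bB xj jK bd Ud; rewrite /cell_bound jK lerD2r.
apply: ge_sup; first by have [] := cell_has_sup j b0 bB.
move=> _ [y [y0 yj] <-]; apply/ltW/Ud => //.
apply: le_lt_trans bd; rewrite ler_pdivlMr// -[X in _ * X](gtr0_norm b0) -normrM.
have -> : (y - x) * b = (b * y - j%:R) - (b * x - j%:R) by ring.
by apply: (le_trans (ler_normB _ _)); lra.
Qed.

Lemma usc_majorants U : bounded_pos U -> usc_pos U ->
  exists Phi : nat -> R -> R, [/\ forall n, test_fun (Phi n),
    forall n (y : R), 0 <= y -> U y < Phi n y,
    exists C : R, forall n (y : R), 0 <= y -> `|Phi n y| <= C &
    forall y : R, 0 <= y -> Phi n y @[n --> \oo] --> U y].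
Proof.
move=> [B bB] uU.
(* The mesh [1 / b n] tends to 0 while the coarse tail starts at [K n / b n = n + 1], which leaves
   every fixed point behind. *)
pose b n : R := n.+1%:R; pose K n := (n.+1 * n.+1)%N.
pose M n := cell_bound U B (b n) (K n).
pose Phi n := staircase (M n) (b n) (K n).
have b1 n : 1 <= b n by rewrite /b ler1n.
have b0 n : 0 < b n by rewrite /b ltr0n.
have tP n := test_fun_staircase (K n) (ltW (b0 n))
  (fun j => cell_bound_norm (K n) j (b1 n) bB).
have near_cell n i x : i%:R <= b n * x <= i.+1%:R ->
    `|b n * x - i%:R| <= 1 /\ `|b n * x - i.+1%:R| <= 1.
  rewrite -natr1 !ler_norml => /andP[h1 h2].
  by split; apply/andP; split; lra.
have UPhi n y : 0 <= y -> U y < Phi n y.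
  move=> y0.
  have [[t /andP[t0 t1] [i _ [iy E]]]|[E _]] :=
      staircase_between (M n) (K n) (mulr_ge0 (ltW (b0 n)) y0).
    have [c1 c2] := near_cell n i y iy.
    have := cell_bound_gt (K n) (b0 n) bB y0 c1; rewrite -/(M n i) => g1.
    have := cell_bound_gt (K n) (b0 n) bB y0 c2; rewrite -/(M n i.+1) => g2.
    rewrite /Phi E; have [h|h] := leP (M n i) (M n i.+1).
      have : 0 <= t * (M n i.+1 - M n i) by rewrite mulr_ge0// subr_ge0.
      by lra.
    have : 0 <= (1 - t) * (M n i - M n i.+1) by rewrite mulr_ge0 ?subr_ge0// ltW.
    by lra.
  rewrite /Phi E /M /cell_bound ltnn.
  by apply: (@le_lt_trans _ _ B); [exact: le_trans (ler_norm _) (bB _ y0)|rewrite ltrDl].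
exists Phi; split=> //.
- by move=> n; have [] := tP n.
- by exists (B + 1) => n; have [] := tP n.
move=> y y0; apply/cvgrPdist_lt => e e0.
have e2 : 0 < e / 2 by rewrite divr_gt0.
have [d d0 Ud] := uU y y0 _ e2.
have nb (r : R) : \forall n \near \oo, r < b n.
  by apply: filterS (nbhs_infty_gtr r) => n /lt_trans; apply; rewrite /b ltr_nat.
have d20 : 0 < 2 / d by rewrite divr_gt0.
near=> n.
have n1 : 2 / d < b n by near: n; exact: nb.
have n2 : (e / 2)^-1 < b n by near: n; exact: nb.
have n3 : y + 1 < b n by near: n; exact: nb.
have bd : 2 / b n < d by rewrite ltr_pdivrMr// mulrC -ltr_pdivrMr.
have be : (b n)^-1 < e / 2 by rewrite -[ltRHS]invrK ltf_pV2 ?posrE ?invr_gt0.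
have KE : (K n)%:R = b n * b n by rewrite /K natrM.
(* The extra 1 puts both knots around [y] at indices below [K n], where [cell_bound] is local. *)
have yK : b n * y + 1 < (K n)%:R by rewrite KE; have := b1 n; have := b0 n; nra.
have Pl := UPhi n y y0.
rewrite distrC ger0_norm ?subr_ge0 ?ltW// ltrBlDl.
have [[t /andP[t0 t1] [i _ [iy E]]]|[E Ky]] :=
      staircase_between (M n) (K n) (mulr_ge0 (ltW (b0 n)) y0); last by lra.
have [c1 c2] := near_cell n i y iy.
have iK : (i.+1 < K n)%N.
  rewrite -(ltr_nat R) -[i.+1%:R]natr1; have /andP[i1 _] := iy.
  by apply: le_lt_trans yK; rewrite lerD2r.
have g1 : M n i <= _ := cell_bound_le (b0 n) bB c1 (ltnW iK) bd Ud.
have g2 : M n i.+1 <= _ := cell_bound_le (b0 n) bB c2 iK bd Ud.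
rewrite /Phi E.
apply: (@le_lt_trans _ _ (U y + e / 2 + (b n)^-1)); last first.
  by rewrite -addrA ltrD2l [ltRHS]splitr ltrD2l.
rewrite [leRHS](_ : _ = (1 - t) * (U y + e / 2 + (b n)^-1) + t * (U y + e / 2 + (b n)^-1)).
  by apply: lerD; rewrite ler_wpM2l// subr_ge0.
by rewrite -mulrDl subrK mul1r.
Unshelve. all: by end_near. Qed.

End Majorants.

(** * Sign of the jump terms at a maximum, and exclusion of interior maxima *)

Section MaximumPoint.
Context {R : realType}.
Variables (F : cumulativeBounded (0:R) (1:R)) (lam c sigma a : R).
Hypotheses (lam0 : 0 < lam) (sigma0 : 0 < sigma).
Implicit Types (U P Q : R -> R) (x d k : R).
Local Notation gen := (diffgen c sigma a).
Local Notation jump := (jump F).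
Local Notation subsol := (subsol F lam c sigma a).
Local Notation mu := (lebesgue_stieltjes_measure F).

Lemma jumpD P Q x (u v : R) : test_fun P -> test_fun Q -> 0 < x ->
  jump P x u + jump Q x v =
  Rintegral mu posR (fun y => (P (x + y) - u) + (Q (x + y) - v)).
Proof.
move=> tP tQ x0; apply: esym.
exact: (@RintegralD _ _ _ mu posR _ _ measurable_posR (jump_integrable F u tP x0)
  (jump_integrable F v tQ x0)).
Qed.

(** [f] lies below [- m] times the indicator of the bounded interval []q, q + 1[], to which full
    support gives positive mass. *)
Lemma integral_neg_of_le_step (f : R -> R) (m q : R) : full_support_pos F ->
  mu.-integrable posR (EFin \o f) -> 0 < m -> 0 <= q ->
  (forall y, 0 < y -> f y <= 0) -> (forall y, q < y -> f y <= - m) ->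
  Rintegral mu posR f < 0.
Proof.
move=> fs fi m0 q0 f0 fm.
have q1 : q < q + 1 by rewrite ltrDl.
have mI : measurable (`]q, q + 1[%classic : set R) by exact: measurable_itv.
have gi : mu.-integrable posR (EFin \o (fun y => - m * \1_(`]q, q + 1[%classic) y)).
  apply: (@integrable_posR _ _ _ m).
    by apply: measurable_funM => //; exact: measurable_indic.
  move=> y _; rewrite normrM normrN (gtr0_norm m0) indicE.
  by case: (_ \in _); rewrite ?normr1 ?normr0 ?mulr1 ?mulr0// ltW.
apply: (@le_lt_trans _ _ (Rintegral mu posR (fun y => - m * \1_(`]q, q + 1[%classic) y))).
  apply: le_Rintegral => //; first exact: measurable_posR.
  move=> y; rewrite /posR /= in_itv/= andbT => y0; rewrite indicE.
  have [|_] := boolP (y \in _); last by rewrite mulr0; exact: f0.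
  by rewrite inE /= in_itv/= => /andP[qy _]; rewrite mulr1; exact: fm.
have -> : Rintegral mu posR (fun y => - m * \1_(`]q, q + 1[%classic) y) =
    - m * fine (mu `]q, q + 1[).
  rewrite (@RintegralZl _ _ _ mu posR _ (- m) measurable_posR).
    congr (_ * _); rewrite /Rintegral integral_indic//=; last exact: measurable_posR.
    congr (fine (mu _)); rewrite setIC; apply/setIidPr => y.
    by rewrite /posR /= !in_itv/= andbT => /andP[qy _]; exact: le_lt_trans qy.
  apply: (@integrable_posR _ _ _ 1); first exact: measurable_indic.
  by move=> y _; rewrite indicE; case: (_ \in _); rewrite ?normr1 ?normr0.
rewrite pmulr_llt0 ?oppr_lt0// fine_gt0// fs//=.
apply: le_lt_trans (probability_le1 mu mI) _; exact: ltry.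
Qed.

(** The integral for [U1 + U2] itself is negative: no jump gains, and jumps larger than [q] lose at
    least [m]. Dominated convergence carries the strict sign to some majorants. *)
Lemma majorants_jump_neg U1 U2 (P Q : nat -> R -> R) (x0 m q : R) : full_support_pos F ->
  0 < x0 -> 0 < m -> 0 <= q ->
  (forall n, test_fun (P n)) -> (forall n, test_fun (Q n)) ->
  (exists C : R, forall n (y : R), 0 <= y -> `|P n y| <= C) ->
  (exists C : R, forall n (y : R), 0 <= y -> `|Q n y| <= C) ->
  (forall y : R, 0 <= y -> P n y @[n --> \oo] --> U1 y) ->
  (forall y : R, 0 <= y -> Q n y @[n --> \oo] --> U2 y) ->
  (forall y, x0 < y -> U1 y + U2 y <= U1 x0 + U2 x0) ->
  (forall y, q < y -> U1 y + U2 y <= U1 x0 + U2 x0 - m) ->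
  exists n, jump (P n) x0 (U1 x0) + jump (Q n) x0 (U2 x0) < 0.
Proof.
move=> fs x0p m0 q0 tP tQ [C1 bP] [C2 bQ] cP cQ W1 W2.
pose f_ n (y : R) := (P n (x0 + y) - U1 x0) + (Q n (x0 + y) - U2 x0).
pose f (y : R) := (U1 (x0 + y) - U1 x0) + (U2 (x0 + y) - U2 x0).
have posE y : posR y -> 0 <= x0 + y.
  by rewrite /posR /= in_itv/= andbT => y0; rewrite addr_ge0// ltW.
have mf_ n : measurable_fun posR (f_ n).
  by apply: measurable_funD; apply: measurable_funB => //; exact: measurable_test_fun_shift.
have f_f y : posR y -> f_ n y @[n --> \oo] --> f y.
  move=> /posE y0; apply: cvgD; apply: cvgB; [exact: cP|exact: cvg_cst|exact: cQ|exact: cvg_cst].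
(* Measurability of [U1] and [U2] is not assumed; it is inherited here from the majorants by
   pointwise limit. *)
have mf : measurable_fun posR f by exact: (measurable_fun_cvg mf_).
pose C := (C1 + `|U1 x0|) + (C2 + `|U2 x0|).
have bf n y : posR y -> `|f_ n y| <= C.
  move=> /posE y0; apply: (le_trans (ler_normD _ _)).
  by apply: lerD; apply: (le_trans (ler_normB _ _)); apply: lerD => //; [exact: bP|exact: bQ].
have h1 n : measurable_fun posR (EFin \o f_ n) by apply/measurable_EFinP; exact: mf_.
have h2 : measurable_fun posR (EFin \o f) by apply/measurable_EFinP; exact: mf.
have h3 : {ae mu, forall y, posR y -> (EFin \o f_ n) y @[n --> \oo] --> (EFin \o f) y}.
  by apply: aeW => y yp; apply: cvg_EFin; [exact: nearW|exact: f_f].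
have h4 : {ae mu, forall y n, posR y -> (`|(EFin \o f_ n) y| <= (EFin \o cst C) y)%E}.
  by apply: aeW => y n yp; rewrite /= lee_fin; exact: bf.
have [fi _ cv] := @dominated_convergence _ _ _ mu posR measurable_posR _ _ _ h1 h2 h3
  (cst_integrable_posR F C) h4.
have neg : Rintegral mu posR f < 0.
  apply: (integral_neg_of_le_step fs fi m0 q0) => y y0.
    by have := W1 (x0 + y); rewrite ltrDl => /(_ y0); rewrite /f; lra.
  have := W2 (x0 + y) (lt_le_trans y0 _); rewrite lerDr ltW// => /(_ isT).
  by rewrite /f; lra.
have cvR : Rintegral mu posR (f_ n) @[n --> \oo] --> Rintegral mu posR f.
  apply: fine_cvg; rewrite fineK; first exact: cv.
  by apply: (integrable_fin_num _ fi); exact: measurable_posR.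
have [n _ /(_ n (leqnn n)) /= hn] := cvgr_lt _ cvR 0 neg.
by exists n; rewrite jumpD.
Qed.

(* Adding the two chords makes the quadratic corrections [k1 + k2 > 0]
   contradict the maximality of [U1 + U2] at [x0]. *)
Lemma no_interior_max U1 U2 P Q (x0 : R) : subsol U1 -> subsol U2 ->
  bounded_pos U1 -> bounded_pos U2 -> usc_pos U1 -> usc_pos U2 ->
  test_fun P -> test_fun Q ->
  (forall y : R, 0 <= y -> U1 y < P y) -> (forall y : R, 0 <= y -> U2 y < Q y) ->
  0 < x0 -> (forall y : R, 0 <= y -> U1 y + U2 y <= U1 x0 + U2 x0) ->
  jump P x0 (U1 x0) + jump Q x0 (U2 x0) < 0 -> False.
Proof.
move=> s1 s2 b1 b2 u1 u2 tP tQ UP UQ x0p Wmax Jneg.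
pose D0 := sigma ^+ 2 * x0 ^+ 2.
have D0p : 0 < D0 by exact: sq_gen_center_gt0.
have D0n : D0 != 0 by rewrite gt_eqF.
set J1 := jump P x0 (U1 x0) in Jneg *; set J2 := jump Q x0 (U2 x0) in Jneg *.
(* A quarter of the total deficit: each inequality then holds at [x0] with margin [ka], and
   [(k1 + k2) * D0 = 4 * ka - 2 * ka] remains positive. *)
pose ka := - (lam * (J1 + J2)) / 4.
have ka0 : 0 < ka by rewrite /ka divr_gt0// oppr_gt0 pmulr_rlt0.
pose k1 := - (lam * J1 + ka) / D0; pose k2 := - (lam * J2 + ka) / D0.
have w1 : k1 * D0 + lam * J1 < 0.
  by rewrite /k1 divfK// opprD addrAC addNr add0r oppr_lt0.
have w2 : k2 * D0 + lam * J2 < 0.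
  by rewrite /k2 divfK// opprD addrAC addNr add0r oppr_lt0.
have k12 : 0 < k1 + k2.
  rewrite /k1 /k2 -mulrDl divr_gt0//.
  suff -> : - (lam * J1 + ka) + - (lam * J2 + ka) = 2 * ka by rewrite mulr_gt0.
  by rewrite /ka; field.
have n1 := subsol_window lam0 sigma0 s1 b1 u1 tP x0p w1.
have n2 := subsol_window lam0 sigma0 s2 b2 u2 tQ x0p w2.
have p0 : 0 < x0 / 2 by rewrite divr_gt0.
have xp : \forall y \near x0, x0 / 2 < y by apply: lt_nbhsr; lra.
have [r2 /= r20 H] := filterI (filterI n1 n2) xp.
pose r := r2 / 2; have r0 : 0 < r by rewrite /r divr_gt0.
have rr : r < r2 by rewrite /r; lra.
have inw t : x0 - r <= t <= x0 + r -> `|x0 - t| < r2.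
  by move=> /andP[t1 t2]; rewrite ltr_norml; apply/andP; split; lra.
have [s ss] := scale_exists c a sigma0 p0.
have xl : x0 - r < x0 by rewrite gtrBl.
have xr : x0 < x0 + r by rewrite ltrDl.
have pz : x0 / 2 < x0 - r.
  by have [] := H (x0 - r) (inw _ _) => //; apply/andP; split; lra.
have chord W Z k : subsol W -> bounded_pos W -> usc_pos W -> test_fun Z ->
    (forall y : R, 0 <= y -> W y < Z y) ->
    (forall t, `|x0 - t| < r2 -> k * gen t (2 * (t - x0)) 2 + lam * jump Z t (W t) < 0) ->
    (s (x0 + r) - s (x0 - r)) * W x0 <= (s (x0 + r) - s x0) * (W (x0 - r) - k * r ^+ 2)
      + (s x0 - s (x0 - r)) * (W (x0 + r) - k * r ^+ 2).
  move=> sW bW uW tZ WZ neg.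
  have := @subsol_chord R F lam c sigma a lam0 W s Z (x0 / 2) x0 (x0 - r) (x0 + r) k
    sW bW uW tZ WZ ss p0 pz xl xr.
  rewrite addrAC subrr add0r sqrrN [x0 + r - x0]addrAC subrr add0r; apply.
  by move=> t /andP[t1 t2]; apply/neg/inw; rewrite !ltW.
have c1 := chord U1 P k1 s1 b1 u1 tP UP (fun t tt => (H t tt).1.1).
have c2 := chord U2 Q k2 s2 b2 u2 tQ UQ (fun t tt => (H t tt).1.2).
have sl : 0 < s x0 - s (x0 - r) by rewrite subr_gt0; exact: scale_lt ss pz xl.
have sr : 0 < s (x0 + r) - s x0.
  by rewrite subr_gt0; apply: (scale_lt ss) xr; lra.
have Wl : U1 (x0 - r) + U2 (x0 - r) <= U1 x0 + U2 x0 by apply: Wmax; lra.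
have Wr : U1 (x0 + r) + U2 (x0 + r) <= U1 x0 + U2 x0 by apply: Wmax; lra.
have kr : 0 < (s (x0 + r) - s (x0 - r)) * ((k1 + k2) * r ^+ 2).
  by rewrite !mulr_gt0 ?exprn_gt0//; lra.
have hl : (s (x0 + r) - s x0) * (U1 (x0 - r) + U2 (x0 - r)) <=
    (s (x0 + r) - s x0) * (U1 x0 + U2 x0) by rewrite ler_pM2l.
have hr : (s x0 - s (x0 - r)) * (U1 (x0 + r) + U2 (x0 + r)) <=
    (s x0 - s (x0 - r)) * (U1 x0 + U2 x0) by rewrite ler_pM2l.
by lra.
Qed.

End MaximumPoint.

(** * Reduction of the comparison principle to an interior maximum *)

Theorem theorem4 (R : realType) (lam c sigma a : R)
  (F : cumulativeBounded (0:R) (1:R)) (U V : R -> R) :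
  0 < lam -> 0 < c -> 0 < sigma -> sigma ^+ 2 / 2 < a ->
  distr_on_pos F -> finite_first_moment F -> full_support_pos F ->
  bounded_pos U -> usc_pos U -> visc_sub lam c sigma a F U ->
  bounded_pos V -> lsc_pos V -> visc_super lam c sigma a F V ->
  U 0 <= V 0 ->
  (forall e : R, 0 < e -> exists N : R, forall u : R, N <= u -> U u - V u <= e) ->
  forall u : R, 0 <= u -> U u <= V u.
Proof.
move=> lam0 _ sigma0 _ _ _ fs bU uU vU bV lV vV UV0 UVoo u u0.
rewrite leNgt; apply/negP => Vu.
have sU := visc_sub_subsol bU uU vU; have sN := visc_super_subsol bV lV vV.
have bN := bounded_posN bV; have uN := lsc_oppP lV.
pose W x := U x + - V x.
have Wu : 0 < W u by rewrite subr_gt0.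
have Wu2 : 0 < W u / 2 by rewrite divr_gt0.
(* The tolerance [W u / 2] does double duty: the maximum over [[0, q]] becomes global, and beyond
   [q] the function [W] stays at least [W u / 2] below it, which is the loss [m] fed to
   [majorants_jump_neg]. *)
have [N WN] := UVoo _ Wu2.
pose q := Num.max N u.
have qu : u <= q by rewrite le_max lexx orbT.
have q0 : 0 <= q := le_trans u0 qu.
have Wq y : q <= y -> W y <= W u / 2.
  by move=> qy; apply: WN; apply: le_trans qy; rewrite le_max lexx.
have [B bB] := bU; have [B' bB'] := bN.
have [x0 /andP[x00 x0q] xmax] : exists2 z, 0 <= z <= q &
    forall x, 0 <= x <= q -> W x <= W z.
  apply: (@usc_attains_max _ W 0 q (B + B')) => //.
    move=> x /andP[x0 _]; apply: lerD.
      exact: le_trans (ler_norm _) (bB _ x0).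
    exact: le_trans (ler_norm _) (bB' _ x0).
  move=> x /andP[x0 _] e e0.
  have [d d0 Wd] := usc_posD uU uN x0 e0.
  by exists d => // y /andP[y0 _]; exact: Wd.
have Wx : W u <= W x0 by apply: xmax; rewrite u0 qu.
have x0p : 0 < x0.
  rewrite lt_neqAle x00 andbT; apply/eqP => x0E; move: Wx; rewrite -x0E /W.
  by move: Wu; rewrite /W; lra.
have Wmax y : 0 <= y -> W y <= W x0.
  move=> y0; have [yq|/ltW /Wq qy] := leP y q; first by apply: xmax; rewrite y0.
  by apply: le_trans qy _; apply: le_trans Wx; lra.
have [P [tP UP bP cP]] := usc_majorants bU uU.
have [Q [tQ UQ bQ cQ]] := usc_majorants bN uN.
have [||n] := majorants_jump_neg fs x0p Wu2 q0 tP tQ bP bQ cP cQ.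
- by move=> y xy; apply: Wmax; exact: le_trans (ltW xy).
- by move=> y /ltW /Wq qy; rewrite /=; move: qy Wx; rewrite /W; lra.
exact: (no_interior_max lam0 sigma0 sU sN bU bN uU uN (tP n) (tQ n) (UP n) (UQ n) x0p).
Qed.
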